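(* Let $S$ be a set and let $\mathcal{CRF}_S$ be the category of rooted forests colored by $S$. Then its Grothendieck group satisfies $K_0(\mathcal{CRF}_S) \simeq \mathbb{Z}^{\oplus |S|}$ (the free abelian group on the set $S$).
   Context: A rooted tree colored by $S$ is a (finite, nonempty) tree $T$ with vertex set $V(T)$, edge set $E(T)$, a distinguished vertex $r(T)\in V(T)$ (the root) and a map $l:V(T)\to S$ (the coloring). Isomorphisms of colored rooted trees are pairs of bijections on vertices and edges preserving roots, colors and incidences. A rooted forest colored by $S$ is either empty (denoted $\emptyset$) or a finite collection $F=\{T_1,\dots,T_n\}$ of such trees; two forests $\{T_1,\dots,T_n\}$, $\{T_1',\dots,T_m'\}$ are isomorphic if $m=n$ and there is a permutation $\sigma$ with $T_i\simeq T'_{\sigma(i)}$ for all $i$. An admissible cut $C$ of a tree $T$ is either a subset $C\subset E(T)$ such that any path from a leaf to the root contains at most one edge of $C$, or the full cut $C_{full}$. Removing the edges of $C$ divides $T$ into the component $R_C(T)$ containing the root, and the colored rooted forest $P_C(T)$ of the remaining components (each rooted at its vertex closest to $r(T)$). For the empty cut $C_{null}=\emptyset$ one has $P_{C_{null}}(T)=\emptyset$, $R_{C_{null}}(T)=T$; for the full cut, $P_{C_{full}}(T)=T$, $R_{C_{full}}(T)=\emptyset$. An admissible cut of a forest $F=\{T_1,\dots,T_k\}$ is a collection $C=\{C_1,\dots,C_k\}$ of admissible cuts $C_i$ of $T_i$, with $P_C(F)=\bigcup_i P_{C_i}(T_i)$ and $R_C(F)=\{R_{C_1}(T_1),\dots,R_{C_k}(T_k)\}$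 (omitting empty entries). The objects of $\mathcal{CRF}_S$ are the rooted forests colored by $S$, and a morphism $F_1\to F_2$ is a triple $(C_1,C_2,f)$ with $C_i$ an admissible cut of $F_i$ and $f:R_{C_1}(F_1)\cong P_{C_2}(F_2)$ an isomorphism of colored forests. The short exact sequences in $\mathcal{CRF}_S$ are, up to isomorphism, the sequences $\emptyset\to P_C(F)\xrightarrow{(C_{null},C,\mathrm{id})}F\xrightarrow{(C,C_{full},\mathrm{id})}R_C(F)\to\emptyset$ for $F$ a forest and $C$ an admissible cut of $F$. $K_0(\mathcal{CRF}_S)$ is the free abelian group on the set $\mathrm{Iso}(\mathcal{CRF}_S)$ of isomorphism classes of objects, modulo the subgroup generated by the elements $B-A-D$ for all short exact sequences $\emptyset\to A\to B\to D\to\emptyset$. *)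

(* Defs.v *)
From HB Require Import structures.
From mathcomp Require Import all_boot all_order all_algebra.
From mathcomp Require Import generic_quotient ring_quotient.
From mathcomp Require Import boolp freeg.

Set Implicit Arguments.
Unset Strict Implicit.
Unset Printing Implicit Defensive.

Import GRing.Theory.

(* Finite graphs: an edge is the two-element set of its endpoints, so that a  *)
(* bijection of vertices carrying edges to edges determines the bijection of  *)
(* edges.                                                                     *)

Definition adj (V : finType) (E : {set {set V}}) : rel V :=
  fun x y => (x != y) && ([set x; y] \in E).

Definition is_tree (V : finType) (E : {set {set V}}) : Prop :=
  [/\ forall e, e \in E -> #|e| = 2,
      forall x y, connect (adj E) x y
    & forall c, ucycle (adj E) c -> (size c <= 2)%N].

(* Length of a shortest walk from x to y. *)
Definition dist (V : finType) (E : {set {set V}}) (x y : V) : nat :=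
  find (fun n => [exists p : n.-tuple V, path (adj E) x p && (last x p == y)])
       (iota 0 #|V|).

Section ColoredTrees.

Variable S : Type.

(* The vertices form an arbitrary finite type in Set, not in the universe of  *)
(* finType: a smallness condition, without which the isomorphism classes of   *)
(* forests could not be the elements of a choiceType. The nonemptiness of the *)
(* tree is witnessed by its root.                                             *)
Record ctree := CTree {
  tcarrier : Set;
  tfinite : Finite tcarrier;
  tedges : {set {set Finite.Pack tfinite}};
  troot : tcarrier;
  tcolor : tcarrier -> S;
  tree_axiom : is_tree tedges
}.

Definition tvert (T : ctree) : finType := Finite.Pack (tfinite T).

Record tree_iso (T1 T2 : ctree) := TreeIso {
  tiso_fun :> tvert T1 -> tvert T2;
  tiso_bij : bijective tiso_fun;
  tiso_root : tiso_fun (troot T1) = troot T2;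
  tiso_color : forall v, tcolor (tiso_fun v) = tcolor v;
  tiso_edges : tedges T2 = [set tiso_fun @: e | e : {set tvert T1} in tedges T1]
}.

Definition forest := seq ctree.

Definition tree_of (F : forest) (i : 'I_(size F)) : ctree := tnth (in_tuple F) i.

Record forest_iso (F1 F2 : forest) := ForestIso {
  fiso_perm :> 'I_(size F1) -> 'I_(size F2);
  fiso_bij : bijective fiso_perm;
  fiso_tree : forall i, tree_iso (tree_of i) (tree_of (fiso_perm i))
}.

Section Cuts.

Variable T : ctree.
Implicit Types (C : {set {set tvert T}}) (v x y : tvert T).

(* A root of valence at most 1 also satisfies this, but the only path from    *)
(* the root to itself has no edges, so that admissible is not affected.       *)
Definition leaf v : bool :=
  (#|[set e in tedges T | v \in (e : {set tvert T})]| <= 1)%N.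

Definition path_edges v (p : seq (tvert T)) : seq {set tvert T} :=
  pairmap (fun x y => [set x; y]) v p.

Definition admissible C : Prop :=
  C \subset tedges T /\
  forall v p, leaf v -> path (adj (tedges T)) v p -> uniq (v :: p) ->
    last v p = troot T -> (count (mem C) (path_edges v p) <= 1)%N.

Inductive cut :=
| PartialCut C of admissible C
| FullCut.

Lemma admissible0 : admissible set0.
Proof.
split=> [|v p _ _ _ _]; first exact: sub0set.
by rewrite (eq_count (a2 := pred0)) ?count_pred0 // => e; rewrite /= inE.
Qed.

Definition null_cut : cut := PartialCut admissible0.

Definition cut_rel C : rel (tvert T) := adj (tedges T :\: C).

Definition cut_comp C v : {set tvert T} := [set y | connect (cut_rel C) v y].

(* The ascription to tcarrier keeps the type in Set. *)
Definition comp_vert C v := {y : tcarrier T | (y : tvert T) \in cut_comp C v}.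
HB.instance Definition _ C v :=
  Finite.copy (comp_vert C v) {y : tvert T | y \in cut_comp C v}.

Definition comp_val C v (x : comp_vert C v) : tvert T := sval x.

Definition comp_edges C v : {set {set comp_vert C v}} :=
  [set e : {set comp_vert C v} | @comp_val C v @: e \in tedges T :\: C].

Lemma cut_rel_sym C : symmetric (cut_rel C).
Proof. by move=> x y; rewrite /cut_rel /adj eq_sym setUC. Qed.

Lemma connect_cut_sym C : connect_sym (cut_rel C).
Proof. exact: sym_connect_sym (@cut_rel_sym C). Qed.

Lemma comp_val_inj C v : injective (@comp_val C v).
Proof. by move=> x y; apply: val_inj. Qed.

Lemma comp_valP C v (x : comp_vert C v) : connect (cut_rel C) v (comp_val x).
Proof. by have := svalP x; rewrite inE. Qed.

Lemma comp_adjE C v (x y : comp_vert C v) :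
  adj (comp_edges C v) x y = cut_rel C (comp_val x) (comp_val y).
Proof.
rewrite /cut_rel /adj in_set imsetU !imset_set1.
by rewrite (inj_eq (@comp_val_inj C v)).
Qed.

Lemma comp_tree_axiom C v : is_tree (comp_edges C v).
Proof.
have [E2 _ Eacyc] := tree_axiom T; split.
- move=> e; rewrite inE => /setDP[/E2].
  by rewrite card_imset //; apply: comp_val_inj.
- move=> x y.
  have: connect (cut_rel C) (comp_val x) (comp_val y).
    by rewrite (connect_trans _ (comp_valP y)) // connect_cut_sym comp_valP.
  case/connectP=> p; elim: p x => [|z p IHp] x /=.
    by move=> _ /comp_val_inj->.
  case/andP=> xz zp yl.
  have vz : z \in cut_comp C v.
    by rewrite inE (connect_trans (comp_valP x)) // connect1.
  pose z' : comp_vert C v := exist _ z vz.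
  apply: connect_trans (IHp z' zp yl).
  by apply: connect1; rewrite comp_adjE.
- move=> c /andP[cyc_c uniq_c].
  rewrite -(size_map (@comp_val C v)); apply: Eacyc.
  rewrite /ucycle (map_inj_uniq (@comp_val_inj C v)) uniq_c andbT.
  rewrite cycle_map; apply: sub_cycle cyc_c => x y /=.
  by rewrite comp_adjE /cut_rel /adj inE => /and3P[-> _ ->].
Qed.

Lemma comp_refl C v : v \in cut_comp C v.
Proof. by rewrite inE. Qed.

(* The component of T minus C containing v, rooted at v. *)
Definition component C v : ctree :=
  @CTree (comp_vert C v) (Finite.on (comp_vert C v)) (comp_edges C v)
    (exist _ v (comp_refl C v)) (fun w => tcolor (comp_val w))
    (@comp_tree_axiom C v).

(* The vertex closest to the root of T in the component of x. *)
Definition nearest C x : tvert T :=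
  [arg min_(y < x in cut_comp C x) dist (tedges T) (troot T) y].

(* One vertex from each component not containing the root of T;               *)
(* fingraph.roots only serves to pick it.                                     *)
Definition detached C : seq (tvert T) :=
  [seq x <- enum (fingraph.roots (cut_rel C)) | x \notin cut_comp C (troot T)].

Definition cutP (c : cut) : forest :=
  match c with
  | PartialCut C _ => [seq component C (nearest C x) | x <- detached C]
  | FullCut => [:: T]
  end.

Definition cutR (c : cut) : option ctree :=
  match c with
  | PartialCut C _ => Some (component C (troot T))
  | FullCut => None
  end.

End Cuts.

Definition fcut (F : forest) := forall i : 'I_(size F), cut (tree_of i).

Definition null_fcut (F : forest) : fcut F := fun i => null_cut (tree_of i).

Definition full_fcut (F : forest) : fcut F := fun i => FullCut (tree_of i).

Definition fcutP (F : forest) (c : fcut F) : forest :=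
  flatten [seq cutP (c i) | i <- enum 'I_(size F)].

Definition fcutR (F : forest) (c : fcut F) : forest :=
  pmap (fun i => cutR (c i)) (enum 'I_(size F)).

Record crf_hom (F1 F2 : forest) := CRFHom {
  hom_dom : fcut F1;
  hom_cod : fcut F2;
  hom_iso : forest_iso (fcutR hom_dom) (fcutP hom_cod)
}.

(* The sequences (C_null, C, phi), (C, C_full, psi) with phi : A ~ P_C(B) and *)
(* psi : R_C(B) ~ D arbitrary isomorphisms: these are the sequences           *)
(* (C_null, C, id), (C, C_full, id) up to isomorphism.                        *)
Definition short_exact (A B D : forest) (i : crf_hom A B) (p : crf_hom B D) :
    Prop :=
  [/\ hom_dom i = @null_fcut A,
      hom_dom p = hom_cod i
    & hom_cod p = @full_fcut D].

Definition forest_equiv : rel {classic forest} :=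
  fun F1 F2 => `[< inhabited (forest_iso F1 F2) >].

Local Open Scope ring_scope.
Local Open Scope quotient_scope.

Lemma tree_iso_refl T : tree_iso T T.
Proof.
exists id => //; first exact: (Bijective (g := id)).
by rewrite (eq_imset (g := id)) ?imset_id // => e; rewrite imset_id.
Qed.

Lemma tree_iso_trans T1 T2 T3 :
  tree_iso T1 T2 -> tree_iso T2 T3 -> tree_iso T1 T3.
Proof.
move=> [f fb fr fc fe] [g gb gr gc ge]; exists (g \o f).
- exact: bij_comp.
- by rewrite /= fr.
- by move=> v; rewrite /= gc fc.
- rewrite ge fe -imset_comp; apply: eq_imset => e.
  by rewrite /= -imset_comp.
Qed.

Lemma bij_inv (A : finType) (B : Type) (f : A -> B) :
  bijective f -> {g : B -> A | cancel f g & cancel g f}.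
Proof. by move=> fb; apply: cid2; case: fb => g fK gK; exists g. Qed.

Lemma tree_iso_sym T1 T2 : tree_iso T1 T2 -> tree_iso T2 T1.
Proof.
move=> [f fb fr fc fe]; have [g fK gK] := bij_inv fb; exists g.
- exact: (Bijective (g := f)).
- by rewrite -fr fK.
- by move=> v; rewrite -fc gK.
- rewrite fe -imset_comp (eq_imset (g := id)) ?imset_id // => e.
  by rewrite /= -imset_comp (eq_imset (g := id)) ?imset_id // => v /=.
Qed.

Lemma forest_equiv_refl : reflexive forest_equiv.
Proof.
move=> F; apply/asboolP; constructor; exists id; first exact: (Bijective (g := id)).
by move=> i; apply: tree_iso_refl.
Qed.

Lemma forest_equiv_sym : symmetric forest_equiv.
Proof.
suff sub F1 F2 : forest_equiv F1 F2 -> forest_equiv F2 F1.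
  by move=> F1 F2; apply/idP/idP; apply: sub.
move=> /asboolP[[f fb ft]]; have [g fK gK] := bij_inv fb.
apply/asboolP; constructor; exists g; first exact: (Bijective (g := f)).
by move=> i; apply: tree_iso_sym; have := ft (g i); rewrite gK.
Qed.

Lemma forest_equiv_trans : transitive forest_equiv.
Proof.
move=> F2 F1 F3 /asboolP[[f fb ft]] /asboolP[[g gb gt]].
apply/asboolP; constructor; exists (g \o f); first exact: bij_comp.
by move=> i; apply: tree_iso_trans (ft i) (gt (f i)).
Qed.

Canonical forest_equiv_rel :=
  EquivRel forest_equiv forest_equiv_refl forest_equiv_sym forest_equiv_trans.

Definition iso_crf := {eq_quot forest_equiv}.
HB.instance Definition _ := Choice.on iso_crf.

Definition iso_class (F : forest) : iso_crf := \pi_iso_crf (F : {classic forest}).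

Definition ses_element (A B D : forest) : {freeg iso_crf / int} :=
  << iso_class B >> - << iso_class A >> - << iso_class D >>.

(* The subgroup generated by the elements B - A - D. *)
Definition ses_subgroup : {pred {freeg iso_crf / int}} := fun g =>
  `[< forall H : {pred {freeg iso_crf / int}}, zmod_closed H ->
      (forall A B D (i : crf_hom A B) (p : crf_hom B D),
         short_exact i p -> ses_element A B D \in H) ->
      g \in H >].

Lemma ses_subgroup_closed : zmod_closed ses_subgroup.
Proof.
split=> [|g h /asboolP gH /asboolP hH]; apply/asboolP => H HZ Hses.
  by case: HZ.
by case: (HZ) => _; apply; [apply: gH | apply: hH].
Qed.

HB.instance Definition _ :=
  GRing.isZmodClosed.Build {freeg iso_crf / int} ses_subgroup ses_subgroup_closed.

Definition K0 := Quotient.quot ses_subgroup.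
HB.instance Definition _ := GRing.Zmodule.on K0.

End ColoredTrees.

(* Main.v *)
Require Import Defs.
From HB Require Import structures.
From mathcomp Require Import all_boot all_order all_algebra.
From mathcomp Require Import generic_quotient ring_quotient.
From mathcomp Require Import boolp freeg.

(** Summing a function [g] of the colors over all vertices of a forest is
    invariant under isomorphism and additive on short exact sequences, because
    the components produced by a cut partition the vertices ([fsum_cut]).
    Hence every [g] with values in an abelian group induces a morphism out of
    K_0 ([fsum_lift]); taking for [g] the tautological map from the colors to
    the free abelian group on them gives the vertex count by color.

    Its inverse sends a color to the class of the one-vertex tree of that color.
    One composite is the identity since the vertex count of such a tree is the
    corresponding generator.  For the other it suffices that the one-vertex
    trees generate K_0; more precisely, the class of a forest is the sum of the
    classes of its vertices ([K0_class_fsum]).  This goes by induction on the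
    number of vertices: in a nonempty forest, cutting all edges at one root and
    cutting off all other trees entirely is an admissible cut whose remainder is
    that single root, so the class of the forest is the class of a one-vertex
    tree plus the class of a forest with one vertex fewer. *)

Set Implicit Arguments.
Unset Strict Implicit.
Unset Printing Implicit Defensive.

Import GRing.Theory.

Local Open Scope ring_scope.
Local Open Scope quotient_scope.

(** * Morphisms out of a free abelian group *)

(** The universal property, for an arbitrary abelian group instead of an
    [lmodType]: the target is regarded as a module over the integers. *)
Lemma freeg_lift (K : choiceType) (M : zmodType) (g : K -> M) :
  exists h : {additive {freeg K / int} -> M}, forall x, h << x >> = g x.
Proof.
pose gz : K -> zmodule M := g.
pose h : {freeg K / int} -> M := fglift gz.
have hB : zmod_morphism h := lift_is_additive gz.
pose hA := GRing.isZmodMorphism.Build _ _ h hB.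
pose ha : {additive {freeg K / int} -> M} := HB.pack h hA.
by exists ha => x; rewrite /ha /= /h liftU scale1r.
Qed.

Lemma freeg_additive_ext (K : choiceType) (M : zmodType)
    (f h : {additive {freeg K / int} -> M}) :
  (forall x, f << x >> = h << x >>) -> f =1 h.
Proof.
move=> fh D; rewrite -(freeg_sumE D) !raddf_sum; apply: eq_bigr => x _.
rewrite -[coeff x D]intz -freegU_mulz.
by rewrite !raddfMz fh.
Qed.

Section ColoredForests.

Variable S : Type.
Implicit Types (F A B D : forest S) (T : ctree S).

(** * Vertex sums *)

Section ColorSum.

Variables (M : nmodType) (g : S -> M).

Definition tsum T : M := \sum_(v : tvert T) g (tcolor v).

Definition fsum F : M := \sum_(T <- F) tsum T.

Lemma tsum_iso T1 T2 : tree_iso T1 T2 -> tsum T1 = tsum T2.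
Proof.
case=> f fb _ fc _; rewrite /tsum (reindex f); last exact: onW_bij.
by apply: eq_bigr => v _; rewrite fc.
Qed.

Lemma fsum_iso F1 F2 : forest_iso F1 F2 -> fsum F1 = fsum F2.
Proof.
case=> s sb st; rewrite /fsum [LHS]big_tnth [RHS]big_tnth [RHS](reindex s);
  last exact: onW_bij.
by apply: eq_bigr => i _; apply: tsum_iso (st i).
Qed.

Lemma tsum_component T (C : {set {set tvert T}}) (v : tvert T) :
  tsum (component C v) = \sum_(y in cut_comp C v) g (tcolor y).
Proof.
rewrite /tsum; transitivity
  (\sum_(y in @comp_val _ _ C v @: [set: comp_vert C v]) g (tcolor y)).
  rewrite big_imset /=; last by move=> x y _ _; apply: comp_val_inj.
  by apply: eq_bigl => x; rewrite inE.
apply: eq_bigl => y; apply/imsetP/idP => [[x _ ->]|yv].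
  by rewrite inE comp_valP.
by exists (exist _ y yv : comp_vert C v); rewrite ?inE.
Qed.

Lemma cut_comp_eq T (C : {set {set tvert T}}) (x y : tvert T) :
  y \in cut_comp C x -> cut_comp C y = cut_comp C x.
Proof.
rewrite inE => xy; apply/setP => z; rewrite !inE.
by rewrite (same_connect (@connect_cut_sym _ _ C) xy).
Qed.

Lemma nearest_in T (C : {set {set tvert T}}) (x : tvert T) :
  nearest C x \in cut_comp C x.
Proof. by rewrite /nearest; case: arg_minnP => //; apply: comp_refl. Qed.

(** The component [cut_comp C x] does not change when [x] is replaced by
    [nearest C x], so the trees of [cutP] together with the root component are
    the classes of the connectedness relation of T minus C, each counted
    once. *)
Lemma tsum_cut T (c : cut T) : fsum (cutP c) + oapp tsum 0 (cutR c) = tsum T.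
Proof.
case: c => [C _|] /=; last by rewrite /fsum big_seq1 addr0.
have csym := @connect_cut_sym _ _ C.
rewrite /fsum big_map /detached big_filter.
rewrite (big_enum_cond _ _ (fingraph.roots (cut_rel C))) /=.
under eq_bigr => x _ do
  rewrite tsum_component (cut_comp_eq (nearest_in C x)).
rewrite tsum_component /tsum.
rewrite [RHS](partition_big (fingraph.root (cut_rel C))
  [in fingraph.roots (cut_rel C)]) /=; last first.
  by move=> v _; apply: roots_root.
pose r := fingraph.root (cut_rel C) (troot T : tvert T).
have rR : r \in fingraph.roots (cut_rel C) by apply: roots_root.
have compE x : x \in fingraph.roots (cut_rel C) ->
    forall y, (fingraph.root (cut_rel C) y == x) = (y \in cut_comp C x).
  by move=> /eqP {1}<- y; rewrite inE (root_connect csym) csym.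
have rT : cut_comp C r = cut_comp C (troot T).
  by apply: cut_comp_eq; rewrite inE connect_root.
rewrite [RHS](bigD1 r) //= [LHS]addrC; congr (_ + _).
  by apply: eq_bigl => y; rewrite compE // rT.
apply: eq_big => [x|x /andP[xR _]]; last first.
  by apply: eq_bigl => y; rewrite compE.
by case xR: (x \in _) => //=; rewrite -rT -compE // (eqP xR).
Qed.

Lemma fsum_cut F (c : fcut F) : fsum (fcutP c) + fsum (fcutR c) = fsum F.
Proof.
rewrite /fsum /fcutP /fcutR big_flatten big_map big_pmap -big_split /=.
rewrite big_enum [RHS]big_tnth; apply: eq_bigr => i _.
exact: tsum_cut.
Qed.

End ColorSum.

(** * Short exact sequences *)

(** The empty cut does not give back [T] on the nose: its vertices are the
    pairs of a vertex of [T] and a proof that it is connected to the root.  The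
    source of a morphism with empty first cut therefore has to be identified
    with the remainder of that cut. *)
Lemma null_cut_iso T : tree_iso (component set0 (troot T)) T.
Proof.
have [_ Tconn _] := tree_axiom T.
have cT (y : tvert T) : y \in cut_comp set0 (troot T : tvert T).
  by rewrite inE /cut_rel setD0.
pose f := @comp_val S T set0 (troot T).
pose h (y : tvert T) : comp_vert set0 (troot T : tvert T) := exist _ y (cT y).
have hK : cancel h f by [].
have fK : cancel f h by move=> x; apply: comp_val_inj.
exists f => //; first exact: Bijective fK hK.
have fhK (e : {set tvert T}) : f @: (h @: e) = e.
  by rewrite -imset_comp (eq_imset (g := id)) ?imset_id.
apply/setP=> e; apply/idP/imsetP => [eT|[e' + ->]].
  by exists (h @: e); rewrite ?fhK // inE fhK setD0.
by rewrite inE setD0.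
Qed.

Lemma map_forest_iso (I : Type) (s : seq I) (f h : I -> ctree S) :
  (forall x, tree_iso (f x) (h x)) -> forest_iso (map f s) (map h s).
Proof.
move=> fh; have sz : size (map f s) = size (map h s) by rewrite !size_map.
exists (cast_ord sz).
  by exists (cast_ord (esym sz)); [apply: cast_ordK|apply: cast_ordKV].
move=> i; have ltis : (i < size s)%N by rewrite -(size_map f).
rewrite /tree_of.
have x0 : I by case: s i {sz ltis} => [[]|x].
rewrite (tnth_nth (f x0)) (tnth_nth (h x0)) /= !(nth_map x0) //.
Qed.

Lemma map_tree_of F : [seq tree_of i | i <- enum 'I_(size F)] = F.
Proof. exact: map_tnth_enum (in_tuple F). Qed.

Lemma fcutP_full F : fcutP (@full_fcut S F) = F.
Proof. by rewrite /fcutP /= flatten_map1 map_tree_of. Qed.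

Lemma fcutR_null_iso F : forest_iso (fcutR (@null_fcut S F)) F.
Proof.
rewrite -[X in forest_iso _ X]map_tree_of /fcutR.
have -> s : pmap (fun i : 'I_(size F) => cutR (null_fcut i)) s =
    [seq component set0 (troot (tree_of i)) | i <- s].
  by elim: s => //= i s ->.
by apply: map_forest_iso => i; apply: null_cut_iso.
Qed.

Lemma forest_iso_refl F : forest_iso F F.
Proof.
exists id; first exact: (Bijective (g := id)).
by move=> i; apply: tree_iso_refl.
Qed.

Lemma fcut_short_exact F (c : fcut F) :
  exists (i : crf_hom (fcutP c) F) (p : crf_hom F (fcutR c)), short_exact i p.
Proof.
have j : forest_iso (fcutR c) (fcutP (@full_fcut S (fcutR c))).
  by rewrite fcutP_full; apply: forest_iso_refl.
by exists (CRFHom (fcutR_null_iso (fcutP c))), (CRFHom j).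
Qed.

Lemma fsum_short_exact (M : nmodType) (g : S -> M) A B D
    (i : crf_hom A B) (p : crf_hom B D) :
  short_exact i p -> fsum g B = fsum g A + fsum g D.
Proof.
case: i p => [i1 c i_iso] [c' p2 p_iso] [/= ei ec ep].
subst i1 c' p2.
rewrite -(fsum_cut g c) -(fsum_iso g i_iso) (fsum_iso g p_iso) fcutP_full.
by rewrite (fsum_iso g (fcutR_null_iso A)).
Qed.

(** * Classes in the Grothendieck group *)

Lemma iso_class_eq F1 F2 : forest_iso F1 F2 -> iso_class F1 = iso_class F2.
Proof. by move=> F12; apply/eqmodP/asboolP. Qed.

Definition K0_class F : K0 S := \pi_(K0 S) << iso_class F >>.

Lemma K0_class_iso F1 F2 : forest_iso F1 F2 -> K0_class F1 = K0_class F2.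
Proof. by rewrite /K0_class => /iso_class_eq->. Qed.

Lemma K0_class_cut F (c : fcut F) :
  K0_class F = K0_class (fcutP c) + K0_class (fcutR c).
Proof.
have [i [p ip]] := fcut_short_exact c.
apply/eqP; rewrite /K0_class -[_ + _]pi_addr; apply/eqP/eqmodP.
rewrite /= /Quotient.equiv; apply/asboolP => H HZ Hses.
by rewrite opprD addrA; apply: Hses ip.
Qed.

Lemma K0_lift (M : zmodType) (h : {additive {freeg (iso_crf S) / int} -> M}) :
  (forall A B D (i : crf_hom A B) (p : crf_hom B D), short_exact i p ->
     h (ses_element A B D) = 0) ->
  exists f : {additive K0 S -> M}, forall x, f (\pi_(K0 S) x) = h x.
Proof.
move=> h0.
have hker x : x \in @ses_subgroup S -> h x = 0.
  move=> /asboolP /(_ [pred y | h y == 0]) hx; apply/eqP/hx.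
    split=> [|y z]; rewrite !inE ?raddf0 // => /eqP hy /eqP hz.
    by rewrite raddfB hy hz subrr.
  by move=> A B D i p /h0 /eqP.
pose f (x : K0 S) := h (repr x).
have fpi x : f (\pi x) = h x.
  apply/eqP; rewrite /f -subr_eq0 -raddfB; apply/eqP/hker.
  by rewrite Quotient.idealrBE reprK.
have fB : zmod_morphism f.
  move=> x y; rewrite -[x]reprK -[y]reprK -pi_oppr -pi_addr !fpi.
  exact: raddfB.
pose fA := GRing.isZmodMorphism.Build _ _ f fB.
by exists (HB.pack f fA : {additive K0 S -> M}).
Qed.

(** * Generation by one-vertex trees *)

Lemma tree_axiom_dot : is_tree (set0 : {set {set unit}}).
Proof.
split=> [e|[] []|c]; rewrite ?inE ?connect0 //.
by case/andP=> _ /card_uniqP <-; rewrite (leq_trans (max_card _)) ?card_unit.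
Qed.

Definition dot (s : S) : ctree S :=
  @CTree S unit (Finite.on unit) set0 tt (fun=> s) tree_axiom_dot.

Lemma dot_iso T : (forall v : tvert T, v = troot T) ->
  tree_iso T (dot (tcolor (troot T))).
Proof.
move=> vT; have [E2 _ _] := tree_axiom T.
exists (fun=> tt) => //; first by exists (fun=> troot T) => [v|[]].
  by move=> v; rewrite (vT v).
apply/esym/setP => e; rewrite [RHS]in_set0; apply/imsetP => -[e' /E2 e'2 _].
have : (#|e'| <= #|[set (troot T : tvert T)]|)%N; last by rewrite cards1 e'2.
by apply/subset_leq_card/subsetP => v _; rewrite inE; apply/eqP/vT.
Qed.

Definition root_star T : {set {set tvert T}} :=
  [set e in tedges T | (troot T : tvert T) \in (e : {set tvert T})].

(** A simple path ending at the root meets it only in its last vertex, so only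
    its last edge can contain the root. *)
Lemma root_star_admissible T : admissible (root_star T).
Proof.
split=> [|v p _]; first by apply/subsetP => e; rewrite inE => /andP[].
elim: p v => //= x p IHp v /andP[_ xp] /andP[vxp xp_uniq] xp_last.
case: (boolP (_ \in root_star T)) => [|_]; last exact: IHp.
(* The edge from [v] to [x] contains the root: [v] is excluded because the
   root occurs later, and if [x] is the root then the path stops there. *)
rewrite !inE => /andP[_ /orP[]] /eqP rE.
  by case/negP: vxp; rewrite -rE -[troot T]xp_last; apply: mem_last.
case: p xp_uniq xp_last {xp IHp vxp} => //= y p /andP[xyp _] yp_last.
by case/negP: xyp; rewrite -rE -[troot T]yp_last; apply: mem_last.
Qed.

Lemma root_star_comp T (v : tvert T) :
  v \in cut_comp (root_star T) (troot T) -> v = troot T.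
Proof.
rewrite inE => /connectP[[|x p] //= /andP[+ _] _].
rewrite /cut_rel /adj !inE eqxx /= andbT andNb andbF //.
Qed.

Lemma root_star_dot T :
  tree_iso (component (root_star T) (troot T)) (dot (tcolor (troot T))).
Proof.
apply: (@dot_iso (component (root_star T) (troot T))) => v.
by apply: comp_val_inj; apply: root_star_comp; rewrite inE comp_valP.
Qed.

(** Both parts of a cut of the empty forest are empty, so its class is twice
    itself. *)
Lemma K0_class_nil : K0_class [::] = 0.
Proof.
have := K0_class_cut (@null_fcut S [::]).
have -> : fcutP (@null_fcut S [::]) = [::].
  by rewrite /fcutP (size0nil (size_enum_ord 0)).
have -> : fcutR (@null_fcut S [::]) = [::].
  by rewrite /fcutR (size0nil (size_enum_ord 0)).
by move/eqP; rewrite -subr_eq subrr => /eqP.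
Qed.

(** Full cuts on the trees of [F], rather than empty ones, leave nothing of
    them in [fcutR]: the remainder is the bare root of [T], and the cut-off
    forest never has to be computed. *)
Definition prune T F : fcut (T :: F) := fun i =>
  if i == ord0 then PartialCut (root_star_admissible (tree_of i))
  else FullCut (tree_of i).

Lemma fcutR_prune T F :
  fcutR (@prune T F) = [:: component (root_star T) (troot T)].
Proof.
rewrite /fcutR enum_ordSl /=; congr (_ :: _).
by elim: (enum _) => //= i s ->.
Qed.

Lemma fcutR_prune_iso T F :
  forest_iso (fcutR (@prune T F)) [:: dot (tcolor (troot T))].
Proof.
rewrite fcutR_prune.
exact: (@map_forest_iso unit [:: tt] (fun=> component (root_star T) (troot T))
  (fun=> dot (tcolor (troot T))) (fun=> root_star_dot T)).
Qed.

Lemma fsum_dot (M : nmodType) (g : S -> M) s : fsum g [:: dot s] = g s.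
Proof.
rewrite /fsum big_seq1 /tsum (eq_bigl (pred1 tt)) ?big_pred1_eq //.
Qed.

Lemma fsum_prune (M : nmodType) (g : S -> M) T F :
  fsum g (T :: F) = fsum g (fcutP (@prune T F)) + g (tcolor (troot T)).
Proof.
rewrite -(fsum_cut g (@prune T F)) (fsum_iso g (fcutR_prune_iso T F)).
by rewrite fsum_dot.
Qed.

(** As [vnum] is itself a vertex sum, [fsum_prune] also shows that pruning
    removes exactly one vertex, which makes the induction go through. *)
Lemma K0_class_fsum F : K0_class F = fsum (fun s => K0_class [:: dot s]) F.
Proof.
pose vnum : forest S -> nat := fsum (fun=> 1%N).
have [n] := ubnP (vnum F); elim: n F => // n IHn [|T F] ltFn.
  by rewrite K0_class_nil /fsum big_nil.
rewrite (K0_class_cut (@prune T F)) (K0_class_iso (fcutR_prune_iso T F)).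
rewrite fsum_prune IHn //.
have vnumE : vnum (T :: F) = (vnum (fcutP (@prune T F)) + 1)%N.
  exact: fsum_prune.
by rewrite vnumE addn1 ltnS in ltFn.
Qed.

(** * The isomorphism *)

Lemma fsum_lift (M : zmodType) (g : S -> M) :
  exists f : {additive K0 S -> M}, forall F, f (K0_class F) = fsum g F.
Proof.
have [h hE] := freeg_lift (fun x : iso_crf S => fsum g (repr x)).
have hF F : h << iso_class F >> = fsum g F.
  rewrite hE.
  have /eqmodP/asboolP[iF] : repr (iso_class F) = F %[mod iso_crf S].
    by rewrite reprK.
  exact: fsum_iso iF.
have [|f fE] := @K0_lift M h.
  by move=> A B D i p ip; rewrite !raddfB /= !hF (fsum_short_exact g ip)
    addrAC addrK subrr.
by exists f => F; rewrite fE hF.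
Qed.

(** Uniqueness in [fsum_lift]: the one-vertex trees generate the group. *)
Lemma K0_additive_ext (M : zmodType) (f h : {additive K0 S -> M}) :
  (forall s, f (K0_class [:: dot s]) = h (K0_class [:: dot s])) -> f =1 h.
Proof.
move=> fh; elim/quotW => x.
apply: (@freeg_additive_ext _ _ (f \o \pi_(K0 S)) (h \o \pi_(K0 S))).
move=> {x} X /=.
rewrite -[X]reprK -[\pi _]/(K0_class (repr X)) K0_class_fsum /fsum !raddf_sum.
apply: eq_bigr => T _; rewrite !raddf_sum; apply: eq_bigr => v _; exact: fh.
Qed.

End ColoredForests.

Theorem lemma2p1 (S : Type) :
  exists f : {additive K0 S -> {freeg {classic S} / int}}, bijective f.
Proof.
have [f fE] := fsum_lift
  (fun s : S => << (s : {classic S}) >> : {freeg {classic S} / int}).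
have [h hE] := freeg_lift (fun s : {classic S} => K0_class [:: dot (s : S)]).
have fhK : cancel h f.
  apply: (@freeg_additive_ext _ _ (f \o h) idfun) => s /=.
  by rewrite hE fE fsum_dot.
exists f, h => // x.
by apply: (@K0_additive_ext S _ (h \o f) idfun) => s /=; rewrite fE fsum_dot hE.
Qed.
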